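(* Let $\mathcal{X}\subseteq\mathbb{R}^d$, $\mathcal{Y}=[K]$, consider an $\ell_p$ norm with $p\in(1,\infty]$, and let $\epsilon>0$. For any $\mu\in\mathcal{P}(\mathcal{X}\times\mathcal{Y})$ with support $s_\mu$ and probability vector $\boldsymbol{\omega}_\mu$, $$1-\mathcal{R}^*_{\mathcal{F}_{\mathrm{det}}}(\mu,\epsilon)=\mathrm{IP}(H_{s_\mu}^\epsilon,\boldsymbol{\omega}_\mu).$$
   Context: Notation: $[K]=\{1,\dots,K\}$; $\Delta^n=\{u\in\mathbb{R}_+^n:\sum_i u^{(i)}=1\}$; $B_p(x,\epsilon)=\{x'\in\mathcal{X}:\|x'-x\|_p\le\epsilon\}$. $\mathcal{P}(\mathcal{Z})$ is the set of probability distributions with finite support on $\mathcal{Z}$; a distribution $\mu\in\mathcal{P}(\mathcal{Z})$ is described by its support $s_\mu=(z_1,\dots,z_n)$ (distinct points) and its probability vector $\boldsymbol{\omega}_\mu\in\Delta^n$, assigning mass $\boldsymbol{\omega}_\mu^{(i)}$ to $z_i$. $\mathcal{F}_{\mathrm{det}}$ is the set of all functions $f:\mathcal{X}\to\mathcal{Y}$, and $$\mathcal{R}^*_{\mathcal{F}_{\mathrm{det}}}(\mu,\epsilon)=\inf_{f\in\mathcal{F}_{\mathrm{det}}}\mathbb{E}_{(x,y)\sim\mu}\Big[\sup_{x'\in B_p(x,\epsilon)}\mathbf{1}\{f(x')\neq y\}\Big].$$ Conflict hypergraph: for $s_\mu=\{(x_i,y_i)\}_{i\in[n]}$, the conflict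 hypergraph $H_{s_\mu}^\epsilon$ has vertex set $[n]$, and a nonempty $e\subseteq[n]$ is a hyperedge iff (1) $y_i\neq y_j$ for all distinct $i,j\in e$, and (2) $\bigcap_{i\in e}B_p(x_i,\epsilon)\neq\emptyset$. Set packing: for a hypergraph $H=([n],\mathcal{E})$ and $\boldsymbol{\omega}\in\mathbb{R}_+^n$, $\mathcal{Q}(H)=\{q\in\{0,1\}^n:\sum_{i\in e}q^{(i)}\le1\ \forall e\in\mathcal{E}\}$ and $\mathrm{IP}(H,\boldsymbol{\omega})=\max_{q\in\mathcal{Q}(H)}\boldsymbol{\omega}^Tq$. *)

(* Defs.v *)
From HB Require Import structures.
From mathcomp Require Import all_boot all_order all_algebra.
From mathcomp Require Import finmap.
From mathcomp Require Import all_classical all_reals all_analysis.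

Set Implicit Arguments.
Unset Strict Implicit.
Unset Printing Implicit Defensive.
Import Order.TTheory GRing.Theory Num.Theory.
Local Open Scope classical_set_scope.
Local Open Scope ring_scope.

(* The case -oo is a dummy value: the norm is only used for 1 < p. *)
Definition lp_norm (R : realType) (d : nat) (p : \bar R) (x : 'rV[R]_d) : R :=
  match p with
  | r%:E => (\sum_(i < d) `|x 0 i| `^ r) `^ r^-1
  | +oo%E => \big[Num.max/0]_(i < d) `|x 0 i|
  | -oo%E => 0
  end.

(* The instance space X is a set of vectors; [x : X] uses the coercion of a
   set to the type of its elements, so the ball below is a subset of X. *)
Definition lp_ball (R : realType) (d : nat) (X : set 'rV[R]_d) (p : \bar R)
    (x : X) (eps : R) : set X :=
  [set x' : X | lp_norm p (val x' - val x) <= eps].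

(* Finitely supported probability distributions, as mass functions. *)
Record fdist (R : realType) (Z : choiceType) := FDist {
  mass :> {fsfun Z -> R with 0};
  mass_ge0 : forall z, 0 <= mass z;
  mass_sum1 : \sum_(z <- finsupp mass) mass z = 1 }.

Definition fdist_expectation (R : realType) (Z : choiceType) (mu : fdist R Z)
    (g : Z -> R) : R :=
  \sum_(z <- finsupp mu) mu z * g z.

Definition simplex (R : realType) (n : nat) : set 'rV[R]_n :=
  [set u | (forall i, 0 <= u 0 i) /\ \sum_(i < n) u 0 i = 1].

(* The points s 0, ..., s (n - 1) are distinct, and mu gives mass w_i to s i.
   As the probability vector ranges over the closed simplex, the s i may
   include points of mass 0; the exact support is the case 0 < w_i. *)
Definition described_by (R : realType) (Z : choiceType) (mu : fdist R Z)
    (n : nat) (s : 'I_n -> Z) (w : 'rV[R]_n) : Prop :=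
  [/\ injective s, simplex w & forall z, mu z = \sum_(i < n | s i == z) w 0 i].

(* The labels {1, ..., K} are represented by 'I_K. *)
Definition F_det (R : realType) (d : nat) (X : set 'rV[R]_d) (K : nat) :
  set (X -> 'I_K) := setT.

Definition adversarial_risk (R : realType) (d : nat) (X : set 'rV[R]_d)
    (K : nat) (p : \bar R) (mu : fdist R (X * 'I_K)%type) (eps : R)
    (f : X -> 'I_K) : R :=
  fdist_expectation mu (fun z : X * 'I_K =>
    sup [set ((f x' != z.2)%:R : R) | x' in lp_ball p z.1 eps]).

Definition optimal_det_risk (R : realType) (d : nat) (X : set 'rV[R]_d)
    (K : nat) (p : \bar R) (mu : fdist R (X * 'I_K)%type) (eps : R) : R :=
  inf [set adversarial_risk p mu eps f | f in @F_det R d X K].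

(* A hypergraph on the vertex set 'I_n, given by its set of hyperedges. *)
Definition hypergraph (n : nat) := {set {set 'I_n}}.

Definition conflict_hypergraph (R : realType) (d : nat) (X : set 'rV[R]_d)
    (K : nat) (p : \bar R) (eps : R) (n : nat) (s : 'I_n -> X * 'I_K) :
    hypergraph n :=
  [set e : {set 'I_n} |
    `[< [/\ e != finset.set0,
         (forall i j, i \in e -> j \in e -> i != j -> (s i).2 != (s j).2) &
         \bigcap_(i in [set` e]) lp_ball p (s i).1 eps !=set0] >] ]%SET.

(* Q(H); a vector q in {0,1}^n is a boolean function on the vertices. *)
Definition packing (n : nat) (H : hypergraph n) : pred {ffun 'I_n -> bool} :=
  fun q => [forall e in H, (\sum_(i in e) (q i : nat) <= 1)%N].

Definition packing_weight (R : realType) (n : nat) (w : 'rV[R]_n)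
    (q : {ffun 'I_n -> bool}) : R :=
  \sum_(i < n) w 0 i * (q i)%:R.

(* The maximum of w^T q over Q(H); the maximiser exists because Q(H) is finite
   and contains 0, which is the starting point given to arg max. *)
Definition IP (R : realType) (n : nat) (H : hypergraph n) (w : 'rV[R]_n) : R :=
  packing_weight w
    [arg max_(q > [ffun=> false] | packing H q) packing_weight w q]%O.

(* Main.v *)
(** A classifier [f] incurs no adversarial loss at a vertex [i] iff it is
    constantly equal to the label of [i] on the ball around [i], so
    [1 - risk f] is the weight of the set of such vertices.  This set is a
    packing, because at a point common to all balls of a hyperedge [f] takes
    only one value.  Conversely, labelling the ball of each vertex of a packing
    by the label of that vertex is consistent: two vertices with different
    labels and intersecting balls would form a hyperedge of size 2.  Hence both
    sides are the maximum weight of a packing. *)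

Require Import Defs.
From mathcomp Require Import all_boot all_order all_algebra.
From mathcomp Require Import finmap.
From mathcomp Require Import all_classical all_reals all_analysis.
Import Order.TTheory GRing.Theory Num.Theory.
Local Open Scope classical_set_scope.
Local Open Scope ring_scope.

Lemma lp_norm0 (R : realType) (d : nat) (p : \bar R) :
  (1%:E < p)%E -> lp_norm p (0 : 'rV[R]_d) = 0.
Proof.
case: p => [r| |] //=; last first.
  by move=> _; apply: (big_ind (fun x : R => x = 0)) => // [x y -> ->|i _];
    rewrite ?maxxx // mxE normr0.
rewrite lte_fin => r1.
(* The exponent must be nonzero because [powR] sends 0 to 1 at exponent 0. *)
have r0 : r != 0 by rewrite gt_eqF // (lt_trans _ r1).
rewrite big1 ?powR0 ?invr_eq0 // => i _.
by rewrite mxE normr0 powR0.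
Qed.

(** Ensures that the supremum defining the loss at a point is taken over a nonempty set. *)
Lemma lp_ball_center (R : realType) (d : nat) (X : set 'rV[R]_d) (p : \bar R)
    (x : X) (eps : R) :
  (1%:E < p)%E -> 0 < eps -> lp_ball p x eps x.
Proof. by move=> hp e0; rewrite /lp_ball /= subrr lp_norm0 // ltW. Qed.

Lemma inf_min (R : realType) (A : set R) (m : R) :
  A m -> lbound A m -> inf A = m.
Proof.
move=> Am lbm; apply/eqP; rewrite eq_le; apply/andP; split.
  by apply: ge_inf => //; exists m.
by apply: lb_le_inf => //; exists m.
Qed.

Lemma sup_indicator_image (R : realType) (T : Type) (A : set T) (b : T -> bool) :
  A !=set0 ->
  sup [set ((b x)%:R : R) | x in A] = (`[< exists2 x, A x & b x >])%:R.
Proof.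
move=> [a Aa].
have ne : [set ((b x)%:R : R) | x in A] !=set0 by exists (b a)%:R, a.
have ub : ubound [set ((b x)%:R : R) | x in A] (`[< exists2 x, A x & b x >])%:R.
  move=> _ [x Ax <-]; case bx : (b x); last exact: ler0n.
  by have /asboolP -> : exists2 x, A x & b x by exists x.
apply/eqP; rewrite eq_le; apply/andP; split; first exact: ge_sup.
have ubs : has_ubound [set ((b x)%:R : R) | x in A].
  by exists (`[< exists2 x, A x & b x >])%:R.
case: asboolP => [[x Ax bx]|_].
  by apply: (ub_le_sup ubs); exists x => //; rewrite bx.
by apply: le_trans (ler0n _ (b a)) _; apply: (ub_le_sup ubs); exists a.
Qed.

Lemma described_by_expectation {R : realType} {Z : choiceType} {mu : fdist R Z}
    {n : nat} {s : 'I_n -> Z} {w : 'rV[R]_n} (g : Z -> R) :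
  described_by mu s w ->
  fdist_expectation mu g = \sum_(i < n) w 0 i * g (s i).
Proof.
move=> [sinj _ muE]; rewrite /fdist_expectation.
have mus i : mu (s i) = w 0 i.
  by rewrite muE (big_pred1 i) // => j; rewrite /= (inj_eq sinj).
under eq_bigr => z _ do rewrite muE mulr_suml.
rewrite (exchange_big_dep xpredT) //=; apply: eq_bigr => i _.
(* A listed point outside [finsupp mu] has mass 0, so [w 0 i] is 0 and its term vanishes on both
   sides. *)
have [si|si] := boolP (s i \in finsupp mu); last first.
  rewrite -mus fsfun_dflt // mul0r big1_seq // => z /andP[/eqP <-].
  by rewrite (negbTE si).
rewrite big_mkcond (bigD1_seq (s i)) ?fset_uniq //= eqxx big1 ?addr0 // => z.
by rewrite eq_sym => /negbTE ->.
Qed.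

(** A sum of booleans over an edge is at most 1 exactly when no two distinct vertices of the edge
    are selected. *)
Lemma packingP (n : nat) (H : hypergraph n) (q : {ffun 'I_n -> bool}) :
  reflect (forall e i j, e \in H -> i \in e -> j \in e -> q i -> q j -> i = j)
    (packing H q).
Proof.
apply: (iffP forall_inP) => [qH e i j eH ie je qi qj|qH e eH].
  apply: contraTeq (qH e eH) => ij.
  by rewrite (bigD1 i) //= (bigD1 j) /= ?je 1?eq_sym // qi qj.
have [/exists_inP[i ie qi]|/exists_inPn nq] := boolP [exists i in e, q i].
  rewrite (bigD1 i) //= qi big1 // => j /andP[je ji].
  by apply/eqP; rewrite eqb0; apply: contra ji => qj; apply/eqP/(qH e).
by rewrite big1 // => i /nq /negbTE ->.
Qed.

Section RobustVertices.
Context {R : realType} {d K : nat} {X : set 'rV[R]_d} {p : \bar R} {eps : R}.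
Context {n : nat} (s : 'I_n -> X * 'I_K).
Implicit Types f : X -> 'I_K.

Let B i := lp_ball p (s i).1 eps.
Let H := conflict_hypergraph p eps s.

Definition robust_vertices f : {ffun 'I_n -> bool} :=
  [ffun i => `[< forall x', B i x' -> f x' = (s i).2 >]].

Lemma packing_robust_vertices f : packing H (robust_vertices f).
Proof.
apply/packingP => e i j; rewrite inE => /asboolP[_ lab [x xe]] ie je.
rewrite !ffunE => /asboolP fi /asboolP fj; apply/eqP.
have [//|/(lab _ _ ie je)] := eqVneq i j.
by rewrite -(fi x (xe i ie)) -(fj x (xe j je)) eqxx.
Qed.

Lemma packing_sub_robust_vertices (y0 : 'I_K) (q : {ffun 'I_n -> bool}) :
  packing H q -> exists f, forall i, q i -> robust_vertices f i.
Proof.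
move=> /packingP qH.
(* Any selected ball containing [x] may supply the label, as all of them agree; [y0] only fills in
   the points outside every selected ball. *)
pose f x := if [pick j | q j && `[< B j x >]] is Some j then (s j).2 else y0.
exists f => i qi; rewrite ffunE; apply/asboolP => x Bix; rewrite /f.
case: pickP => [j /andP[qj /asboolP Bjx]|/(_ i)]; last first.
  by rewrite qi /=; case: asboolP.
apply/eqP/negPn/negP => sji.
suff ij : i = j by rewrite ij eqxx in sji.
apply: (qH [set i; j]%SET); rewrite ?finset.set21 ?finset.set22 //.
rewrite inE; apply/asboolP; split.
- by apply/finset.set0Pn; exists i; rewrite finset.set21.
- move=> k l; rewrite !finset.in_set2.
  by move=> /orP[]/eqP-> /orP[]/eqP->;
    rewrite ?eqxx // => _; rewrite // eq_sym.
- by exists x => k /=; rewrite finset.in_set2 => /orP[]/eqP->.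
Qed.

(** The loss at vertex [i] is the complement of the indicator of robustness at [i]; writing 1 as the
    sum of the weights turns this into an identity term by term. *)
Lemma adversarial_riskE (mu : fdist R (X * 'I_K)%type) (w : 'rV[R]_n) f :
  (1%:E < p)%E -> 0 < eps -> described_by mu s w ->
  adversarial_risk p mu eps f = 1 - packing_weight w (robust_vertices f).
Proof.
move=> hp e0 hmu; rewrite /adversarial_risk (described_by_expectation _ hmu).
case: hmu => _ [_ w1] _; rewrite -[X in _ = X - _]w1 -sumrB.
apply: eq_bigr => i _.
rewrite /= sup_indicator_image; last first.
  by exists (s i).1; exact: lp_ball_center.
rewrite -{2}[w 0 i]mulr1 -mulrBr ffunE; congr (_ * _).
case: asboolP => [[x Bx /eqP fx]|nex]; case: asboolP => [rob|nrob].
- by case: fx; exact: rob.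
- by rewrite subr0.
- by rewrite subrr.
- case: nrob => x Bx; apply/eqP/negPn/negP => fx.
  by apply: nex; exists x.
Qed.

End RobustVertices.

Lemma packing_weight_le {R : realType} {n : nat} {w : 'rV[R]_n}
    {q q' : {ffun 'I_n -> bool}} :
  (forall i, 0 <= w 0 i) -> (forall i, q i -> q' i) ->
  packing_weight w q <= packing_weight w q'.
Proof.
move=> w0 qq'; apply: ler_sum => i _; apply: ler_wpM2l => //.
by rewrite ler_nat; case: (q i) (qq' i) => // ->.
Qed.

Theorem theorem3p1 (R : realType) (d K : nat) (X : set 'rV[R]_d)
    (p : \bar R) (hp : (1%:E < p)%E) (eps : R) (heps : 0 < eps)
    (mu : fdist R (X * 'I_K)%type)
    (n : nat) (s : 'I_n -> X * 'I_K) (w : 'rV[R]_n)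
    (hmu : described_by mu s w) :
  1 - optimal_det_risk p mu eps = IP (conflict_hypergraph p eps s) w.
Proof.
have [_ [w0 w1] _] := hmu.
(* Weights summing to 1 force [n] to be positive; the label of [i0] then serves as the default label
   of the classifier. *)
have [i0 _] : exists i0 : 'I_n, true.
  case: n s w w1 {hmu w0} => [s w|n' *]; last by exists ord0.
  by rewrite big_ord0 => /eqP; rewrite eq_sym oner_eq0.
rewrite /IP; case: arg_maxP => [|q qP qmax].
  by apply/packingP => e i j _ _ _; rewrite ffunE.
have [f fq] := packing_sub_robust_vertices s (s i0).2 q qP.
rewrite /optimal_det_risk (@inf_min _ _ (1 - packing_weight w q)) ?subKr //.
  exists f => //; rewrite (adversarial_riskE s mu w) //; congr (1 - _).
  (* The classifier [f] may be robust at vertices outside [q], but its robust vertices form a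
     packing too, so maximality of [q] leaves the extra ones no total weight. *)
  apply/le_anti/andP; split; last exact: packing_weight_le.
  by apply: qmax; exact: packing_robust_vertices.
move=> _ [g _ <-]; rewrite (adversarial_riskE s mu w) // lerD2l lerN2.
by apply: qmax; exact: packing_robust_vertices.
Qed.
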